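(* Let $X$ be a semitopological Mal'cev algebra whose underlying space is a Korovin space. Then the Mal'cev operation on $X$ extends to a separately continuous Mal'cev operation $(\beta X)^3\to\beta X$ on $\beta X$.
   Context: All spaces are Tychonoff; $\beta X$ is the Stone–Čech compactification. A Mal'cev operation on a set $X$ is a map $\mu\colon X^3\to X$ with $\mu(y,y,x)=\mu(x,y,y)=x$ for all $x,y\in X$. A semitopological Mal'cev algebra is a space $X$ with a Mal'cev operation that is separately continuous (continuous in each of its three arguments when the other two are fixed). A pair of spaces $(S,T)$ is Grothendieck if for every continuous map $\varphi\colon S\to C_p(T)$ the closure of $\varphi(S)$ in $C_p(T)$ is compact, where $C_p(T)$ is the space of continuous real-valued functions on $T$ with the topology of pointwise convergence. A space $X$ is Korovin if the pair $(X,X)$ is Grothendieck. *)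

(* Defs.v *)
From HB Require Import structures.
From mathcomp Require Import all_boot all_order all_algebra.
From mathcomp Require Import all_classical all_reals all_analysis.
Import Order.TTheory GRing.Theory Num.Theory.
Import numFieldNormedType.Exports.

Set Implicit Arguments.
Unset Strict Implicit.
Unset Printing Implicit Defensive.

Local Open Scope classical_set_scope.
Local Open Scope ring_scope.

Definition tychonoff_space (X : topologicalType) : Prop :=
  hausdorff_space X /\ completely_regular_space X.

(* The carrier is an alias, because [continuousType T R] carries no canonical
   topology; the one chosen here is induced from the product [{ptws T -> R}]. *)
Definition Cp (R : realType) (T : topologicalType) : Type := continuousType T R.

HB.instance Definition _ (R : realType) (T : topologicalType) :=
  Topological.copy (Cp R T)
    (initial_topology (fun f : continuousType T R => (f : {ptws T -> R}))).

Definition grothendieck_pair (R : realType) (S T : topologicalType) : Prop :=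
  forall phi : S -> Cp R T, continuous phi -> compact (closure (range phi)).

Definition korovin_space (R : realType) (X : topologicalType) : Prop :=
  tychonoff_space X /\ grothendieck_pair R X X.

Definition malcev_operation (X : Type) (mu : X -> X -> X -> X) : Prop :=
  forall x y, mu y y x = x /\ mu x y y = x.

Definition separately_continuous (X : topologicalType)
    (mu : X -> X -> X -> X) : Prop :=
  [/\ forall y z, continuous (fun x => mu x y z),
      forall x z, continuous (fun y => mu x y z) &
      forall x y, continuous (fun z => mu x y z)].

Definition semitopological_malcev_algebra (X : topologicalType)
    (mu : X -> X -> X -> X) : Prop :=
  [/\ tychonoff_space X, malcev_operation mu & separately_continuous mu].

Definition topological_embedding (X Y : topologicalType) (e : X -> Y) : Prop :=
  injective e /\
  forall U : set X, open U <-> exists2 V : set Y, open V & e @^-1` V = U.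

Definition compactification (X bX : topologicalType) (e : X -> bX) : Prop :=
  [/\ hausdorff_space bX, compact [set: bX],
      topological_embedding e & dense (range e)].

(* Uniqueness of the extension [g'] is automatic: [range e] is dense and [K] is
   Hausdorff. *)
Definition stone_cech_compactification (X bX : topologicalType)
    (e : X -> bX) : Prop :=
  compactification e /\
  forall (K : topologicalType) (g : X -> K),
    hausdorff_space K -> compact [set: K] -> continuous g ->
    exists2 g' : bX -> K, continuous g' & forall x, g' (e x) = g x.

(* Main.v *)
(* A Korovin space X is pseudocompact, so every sequence of nonempty open sets
   of bX accumulates at a point of X, and every nonempty zero set of bX meets X.
   Hence the two iterated limits of a separately continuous map on X * X agree,
   which extends it to bX * bX; extending two variables at a time handles mu.
   The identities mu (x, y, y) = mu (y, y, x) = x repeat a variable, so they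
   do not pass to bX by density. For them one shows that a separately continuous
   g on bX * bX that vanishes on the diagonal of X vanishes at every (q, q): if
   g (q, q) > 0, Namioka's theorem provides points v_n and neighbourhoods V_n
   of them on which g (z, .) is almost constant uniformly in z, with g bounded
   below on V_n * {v_j} for j < n; at a point z of X where the V_n accumulate,
   g (z, z) > 0. *)
Require Import Defs.
From mathcomp Require Import all_boot all_order all_algebra.
From mathcomp Require Import all_classical all_reals all_analysis.
From mathcomp Require Import lra.
Import Order.TTheory GRing.Theory Num.Theory.
Import numFieldNormedType.Exports.

Set Implicit Arguments.
Unset Strict Implicit.
Unset Printing Implicit Defensive.

Local Open Scope classical_set_scope.
Local Open Scope ring_scope.

(** * Dependent choice and limits along ultrafilters *)

(** Dependent choice in which each new term is constrained by all earlier ones. A history of length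
    [n] is a total function of which only the values below [n] matter. *)
Lemma history_choice (T : Type) (x0 : T) (I : nat -> T -> Prop)
    (L : nat -> T -> T -> Prop) :
  (forall n (v : nat -> T),
    (forall i, (i < n)%N ->
       I i (v i) /\ forall j, (j < i)%N -> L i (v j) (v i)) ->
    exists x, I n x /\ forall j, (j < n)%N -> L n (v j) x) ->
  exists u : nat -> T,
    forall n, I n (u n) /\ forall j, (j < n)%N -> L n (u j) (u n).
Proof.
move=> step.
have /choice[c cP] : forall nv : nat * (nat -> T), exists x,
    (forall i, (i < nv.1)%N ->
       I i (nv.2 i) /\ forall j, (j < i)%N -> L i (nv.2 j) (nv.2 i)) ->
    I nv.1 x /\ forall j, (j < nv.1)%N -> L nv.1 (nv.2 j) x.
  move=> nv; have [/step[x xP]|nh] := pselect (forall i, (i < nv.1)%N ->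
       I i (nv.2 i) /\ forall j, (j < i)%N -> L i (nv.2 j) (nv.2 i)).
    by exists x.
  by exists x0 => /nh.
(* [s n] records the first [n] choices and equals [x0] from index [n] on. *)
pose s := fix s (n : nat) : nat -> T := if n is m.+1 then
  fun i => if i == m then c (m, s m) else s m i else fun=> x0.
pose u n := c (n, s n).
have sE n i : (i < n)%N -> s n i = u i.
  elim: n => // n IHn; rewrite ltnS leq_eqVlt /=.
  by case: eqVneq => [->//|_ /= /IHn].
exists u => n; have [m] := ubnP n; elim: m n => // m IHm n nm.
have /= [] := cP (n, s n).
  move=> i in0; rewrite !sE//; have [|Ii Li] := IHm i.
    exact: leq_trans in0 nm.
  split=> // j ji; rewrite !sE//; first exact: Li.
  exact: ltn_trans ji in0.
by move=> In Ln; split=> // j jn; rewrite -(sE n)//; exact: Ln.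
Qed.

Lemma free_ultrafilter : exists F : set_system nat, UltraFilter F /\ \oo `<=` F.
Proof. exact: ultraFilterLemma. Qed.

Lemma ultra_compact_cvg (I : Type) (F : set_system I) (K : topologicalType)
    (A : set K) (u : I -> K) :
  UltraFilter F -> compact A -> (forall i, A (u i)) ->
  exists l : K, u @ F --> l.
Proof.
move=> FU cA uA.
have /cA[l [_ lu]] : (u @ F) A by apply: nearW; exact: uA.
exists l => B lB; have [//|FB] := in_ultra_setVsetC (u @^-1` B) FU.
by have [y []] := lu (~` B) B FB lB.
Qed.

(** By density, the traces on [X] of the neighbourhoods of [p] generate a proper filter. *)
Lemma dense_ultra (X K : topologicalType) (e : X -> K) (p : K) :
  dense (range e) -> exists F : set_system X, UltraFilter F /\ e @ F --> p.
Proof.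
move=> de.
pose G := filter_from (nbhs p) (fun U => e @^-1` U).
have PG : ProperFilter G.
  apply: filter_from_proper.
    apply: filter_from_filter; first by exists setT; exact: filterT.
    by move=> A B pA pB; exists (A `&` B) => //; exact: filterI.
  move=> A pA; move: (pA); rewrite nbhsE => -[W [oO Op] OA].
  have [|y [Wy [x _ exy]]] := de W _ oO; first by exists p.
  by exists x; apply: OA; rewrite exy.
have [F [FU GF]] := ultraFilterLemma PG.
by exists F; split=> // A pA; apply: GF; exists A.
Qed.

Lemma dense_eq (X K L : topologicalType) (e : X -> K) (f g : K -> L) :
  hausdorff_space L -> dense (range e) -> continuous f -> continuous g ->
  (forall x, f (e x) = g (e x)) -> f =1 g.
Proof.
move=> hL de cf cg fg p; have [F [FU eF]] := dense_ultra p de.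
apply: (cvg_unique hL (F := f \o e @ F)).
  by apply: cvg_comp eF _; exact: cf.
have -> : f \o e = g \o e by apply/funext => x /=.
by apply: cvg_comp eF _; exact: cg.
Qed.

(** * Real-valued functions on compact Hausdorff spaces *)

Lemma compact_point_separator (R : realType) (K : topologicalType) (p : K)
    (B : set K) :
  hausdorff_space K -> compact [set: K] -> closed B -> ~ B p ->
  exists f : K -> R, [/\ continuous f, f p = 0 & forall q, B q -> f q = 1].
Proof.
move=> hK cK cB Bp.
have cr := normal_completely_regular (compact_normal hK cK)
  (hausdorff_accessible hK).
have /(@uniform_separatorP _ R)[f [cf _ f0 f1]] := cr R p B cB Bp.
exists f; split=> // [|q Bq]; first by apply: f0; exists p.
by apply: f1; exists q.
Qed.

Lemma compact_separation (R : realType) (K : topologicalType) (p q : K) :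
  hausdorff_space K -> compact [set: K] -> p <> q ->
  exists f : K -> R, [/\ continuous f, f p = 0 & f q = 1].
Proof.
move=> hK cK pq.
have [|//|f [cf fp fq]] := @compact_point_separator R K p [set q] hK cK.
  by apply: accessible_closed_set1; exact: hausdorff_accessible.
by exists f; split=> //; exact: fq.
Qed.

(** Real functions separate points of [K] from closed sets, so they induce its topology. *)
Lemma compact_continuous (R : realType) (T K : topologicalType) (u : T -> K) :
  hausdorff_space K -> compact [set: K] ->
  (forall f : K -> R, continuous f -> continuous (f \o u)) -> continuous u.
Proof.
move=> hK cK fu t A; rewrite nbhsE => -[W [oW Wt] WA].
have [||f [cf ft f1]] := @compact_point_separator R K (u t) (~` W) hK cK.
- exact: open_closedC.
- by move=> /(_ Wt).
have /(cvgr_lt _ (fu f cf t)) : (f \o u) t < 1 by rewrite /= ft.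
apply: filterS => s fs; apply: WA; apply: contrapT => nW.
by move: fs; rewrite /= f1// ltxx.
Qed.

(** * Pseudocompactness and locally finite families *)

(** Without such a [z] the family [U] is locally finite, and bump functions of height [n] vanishing
    off [U n] add up to a continuous unbounded function. *)
Lemma locally_finite_cluster (R : realType) (X : topologicalType)
    (U : nat -> set X) :
  completely_regular_space X ->
  (forall h : X -> R, continuous h -> exists M, forall x, h x <= M) ->
  (forall n, open (U n)) -> (forall n, U n !=set0) ->
  exists z : X, forall O, nbhs z O -> forall N,
    exists2 n, (N <= n)%N & O `&` U n !=set0.
Proof.
move=> cr bd oU U0; apply: contrapT => /forallNP nz.
have /choice[oN oNP] : forall z : X, exists ON : set X * nat, nbhs z ON.1 /\
    forall n, (ON.2 <= n)%N -> ON.1 `&` U n = set0.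
  move=> z; have /existsNP[W /not_implyP[zO /existsNP[N nN]]] := nz z.
  exists (W, N); split=> //= n Nn; apply/eqP; apply: contrapT => /negP/set0P ne.
  by apply: nN; exists n.
pose O z := (oN z).1; pose N z := (oN z).2.
have zO z : nbhs z (O z) by case: (oNP z).
have ON z n : (N z <= n)%N -> O z `&` U n = set0 by case: (oNP z) => _; exact.
have /choice[x xU] := U0.
have /choice[f fP] : forall n, exists f : X -> R,
    [/\ continuous f, (forall y, 0 <= f y), f (x n) = n%:R &
        forall y, ~ U n y -> f y = 0].
  move=> n; have /(@uniform_separatorP _ R)[f [cf f01 f0 f1]] :
      uniform_separator [set x n] (~` U n).
    by apply: cr; [exact: open_closedC|move=> /(_ (xU n))].
  exists (fun y => n%:R * (1 - f y)); split.
  - move=> y; apply: cvgM; first exact: cvg_cst.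
    by apply: cvgB; [exact: cvg_cst|exact: cf].
  - move=> y; apply: mulr_ge0 => //; rewrite subr_ge0.
    have /f01 : range f (f y) by exists y.
    by rewrite /= in_itv /= => /andP[].
  - by rewrite (f0 (f (x n))) ?subr0 ?mulr1//; exists (x n).
  - by move=> y Uy; rewrite (f1 (f y)) ?subrr ?mulr0//; exists y.
(* The number of summands varies with [y]. For [y] in [O z] it may be replaced by [N z], since all
   terms from [N z] or from [N y] on vanish at [y]. *)
pose h y := \sum_(i < N y) f i y.
have hE z y : O z y -> h y = \sum_(i < N z) f i y.
  move=> Ozy.
  have f0 i : (minn (N z) (N y) <= i)%N -> f i y = 0.
    move=> le_i; have [_ _ _ ->//] := fP i => Uy.
    move: le_i; rewrite geq_min => /orP[/ON|/ON] E.
      by rewrite -[False]/(set0 y) -E.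
    by rewrite -[False]/(set0 y) -E; split=> //; exact: nbhs_singleton.
  have trunc m : (minn (N z) (N y) <= m)%N ->
      \sum_(i < m) f i y = \sum_(i < minn (N z) (N y)) f i y.
    move=> le_m; rewrite -!(big_mkord xpredT (fun i => f i y)).
    rewrite (@big_cat_nat _ _ _ (minn (N z) (N y)) 0 m)//=.
    rewrite -[RHS]addr0; congr (_ + _); rewrite big_nat big1// => i /andP[+ _].
    exact: f0.
  by rewrite /h !trunc ?geq_minl ?geq_minr.
have ch : continuous h.
  move=> z; apply: (@cvg_trans _ ((fun y => \sum_(i < N z) f i y) @ z)).
    by apply: near_eq_cvg; apply: filterS (zO z) => y Ozy; rewrite (hE z y).
  rewrite [h z](hE z z (nbhs_singleton (zO z))).
  apply: (@cvg_big R _ +%R).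
    exact: add_continuous.
  by move=> i _; have [cf _ _ _] := fP i; exact: cf.
have [M hM] := bd h ch.
pose n := (Num.truncn M).+1.
have : n%:R <= h (x n).
  have nN : (n < N (x n))%N.
    rewrite ltnNge; apply/negP => /ON E.
    rewrite -[False]/(set0 (x n)) -E; split; last exact: xU.
    exact: nbhs_singleton (zO _).
  rewrite /h (bigD1 (Ordinal nN))//=; have [_ _ -> _] := fP n.
  by rewrite lerDl; apply: sumr_ge0 => i _; have [] := fP i.
move=> /le_trans/(_ (hM _)).
by apply/negP; rewrite -ltNge; exact: truncnS_gt.
Qed.

(** * Namioka's theorem and values on the diagonal *)

Lemma near_all_ltn (T : topologicalType) (t : T) n (P : nat -> set T) :
  (forall j, (j < n)%N -> nbhs t (P j)) ->
  \forall s \near t, forall j, (j < n)%N -> P j s.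
Proof.
move=> tP; have : \forall s \near t, forall j : 'I_n, P j s.
  by apply: filter_forall => j; exact: tP.
by apply: filterS => s Ps j jn; exact: Ps (Ordinal jn).
Qed.

Lemma near_dist (R : realType) (T : topologicalType) (f : T -> R) t (eps : R) :
  {for t, continuous f} -> 0 < eps -> \forall s \near t, `|f s - f t| < eps.
Proof. by move=> cf e0; exact: cvgr_distC_lt. Qed.

(* Namioka's theorem. If it fails, one can keep choosing d_n and pairs
   (z_n, z'_n) that g separates by less than eps / 6 at d_0, ..., d_(n-1) but by
   more than eps / 3 on a neighbourhood of d_n containing all later d_m; limits
   of d_n, z_n, z'_n along an ultrafilter then give a contradiction. *)
Lemma near_equicontinuous (R : realType) (K L : topologicalType)
    (g : K -> L -> R) (U : set K) (eps : R) :
  compact [set: K] -> compact [set: L] ->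
  (forall z, continuous (g^~ z)) -> (forall o, continuous (g o)) ->
  open U -> U !=set0 -> 0 < eps ->
  exists2 o, U o & \forall o' \near o, forall z, `|g o' z - g o z| <= eps.
Proof.
move=> cK cL cg1 cg2 oU [w0 Uw0] eps0.
apply: contrapT => /forallPNP noo.
have [z0 _] : exists z0 : L, True.
  apply: contrapT => nz; apply: (noo _ Uw0); apply: nearW => o z.
  by exfalso; apply: nz; exists z.
pose e := eps / 3; have e0 : 0 < e by rewrite divr_gt0.
(* A term consists of a neighbourhood, its point d_n, and the pair z_n, z'_n. *)
pose T : Type := (set K * K) * (L * L).
pose I (n : nat) (x : T) := [/\ open x.1.1, x.1.1 `<=` U, x.1.1 x.1.2 &
  forall o, x.1.1 o -> e < `|g o x.2.1 - g o x.2.2|].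
pose J (n : nat) (y x : T) := x.1.1 `<=` y.1.1 /\
  `|g y.1.2 x.2.1 - g y.1.2 x.2.2| < e / 2.
have [u uP] : exists u : nat -> T,
    forall n, I n (u n) /\ forall j, (j < n)%N -> J n (u j) (u n).
  apply: (history_choice (U, w0, (z0, z0))) => n v vP.
  have [W [opW WU [w1 Wo1] WV]] : exists W : set K, [/\ open W, W `<=` U,
      W !=set0 & forall j, (j < n)%N -> W `<=` (v j).1.1].
    case: n vP => [|n] vP; first by exists U; split=> //; exists w0.
    have [[opW WU Wd _] VJ] := vP n (ltnSn n).
    exists (v n).1.1; split=> //; first by exists (v n).1.2.
    by move=> j; rewrite ltnS leq_eqVlt => /predU1P[->//|/VJ[]].
  have [[[w [z z']] /= [Ww jz wz]]|nW] := pselect (exists x : K * (L * L),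
      [/\ W x.1, forall j, (j < n)%N ->
            `|g (v j).1.2 x.2.1 - g (v j).1.2 x.2.2| < e / 2
        & e < `|g x.1 x.2.1 - g x.1 x.2.2| ]).
    have cgz : continuous (fun p => `|g p z - g p z'|).
      by move=> p; apply: cvg_norm; apply: cvgB; exact: cg1.
    exists (W `&` [set p | e < `|g p z - g p z'|], w, (z, z')); split.
      split=> //=; [|by move=> p [/WU]|by move=> p []].
      apply: openI => //; apply: (open_comp (f := fun p => `|g p z - g p z'|)
        (D := [set x | e < x])).
        by move=> p _; exact: cgz.
      exact: open_gt.
    by move=> j jn; split=> /=; [move=> p [/(WV j jn)]|exact: jz].
  (* With no further pair available, every [z'] close to [z] satisfies [|g p z' - g p z| <= e] for
     all [p] in [W]. Compactness of [L] makes the estimate uniform, and three errors [e] add up to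
     [eps]. *)
  exfalso; apply: (noo w1); first exact: WU.
  have /compact_near_coveringP/(_ _ (nbhs w1)
    (fun o z => `|g o z - g w1 z| <= eps) _) := cL.
  move=> cov; apply: filterS (cov _); first by move=> o + z; apply.
  move=> z _; exists ([set z' | forall j, (j < n)%N ->
      `|g (v j).1.2 z' - g (v j).1.2 z| < e / 2],
    W `&` [set o | `|g o z - g w1 z| < e]) => /=.
    split; last first.
      apply: filterI; first exact: open_nbhs_nbhs.
      by apply: near_dist => //; exact: cg1.
    apply: near_all_ltn => j _; apply: near_dist; first exact: cg2.
    by rewrite divr_gt0.
  move=> [z' o] /= [zz' [Wo oz]].
  have E p : W p -> `|g p z' - g p z| <= e.
    move=> Wp; rewrite leNgt; apply/negP => lt_e.
    by apply: nW; exists (p, (z', z)).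
  have := E _ Wo; have := E _ Wo1; move: oz.
  have -> : eps = e + e + e by rewrite /e; lra.
  rewrite !ler_norml !ltr_norml => /andP[? ?] /andP[? ?] /andP[? ?].
  by apply/andP; split; lra.
have [F [FU ooF]] := free_ultrafilter.
have [d du] := ultra_compact_cvg (u := fun n => (u n).1.2) FU cK
  (fun=> Logic.I).
have [z zu] := ultra_compact_cvg (u := fun n => (u n).2.1) FU cL
  (fun=> Logic.I).
have [z' zu'] := ultra_compact_cvg (u := fun n => (u n).2.2) FU cL
  (fun=> Logic.I).
have later j : \forall n \near F, (j < n)%N.
  by apply: ooF; exact: nbhs_infty_gt.
have lim1 x x' : (fun n => `|g (u n).1.2 x - g (u n).1.2 x'|) @ F
    --> `|g d x - g d x'|.
  by apply: cvg_norm; apply: cvgB; exact: (cvg_comp _ _ du (cg1 _ d)).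
have lim2 o : (fun n => `|g o (u n).2.1 - g o (u n).2.2|) @ F
    --> `|g o z - g o z'|.
  apply: cvg_norm; apply: cvgB; first exact: (cvg_comp _ _ zu (cg2 _ z)).
  exact: (cvg_comp _ _ zu' (cg2 _ z')).
(* The limit in d_m before the one in the pairs gives at least [e]; the opposite order gives at most
   [e / 2]. *)
have : e <= `|g d z - g d z'|.
  apply: (cvgr_to_ge (lim2 d)); apply: nearW => n.
  apply: (cvgr_to_ge (lim1 _ _)); apply: filterS (later n) => m nm.
  have [[_ _ _ un] _] := uP n; have [[_ _ um _] uJ] := uP m.
  by apply/ltW/un; have [+ _] := uJ n nm; apply.
have : `|g d z - g d z'| <= e / 2.
  apply: (cvgr_to_le (lim1 _ _)); apply: nearW => j.
  apply: (cvgr_to_le (lim2 _)); apply: filterS (later j) => n jn.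
  by have [_ /(_ j jn)[_ /ltW]] := uP n.
by lra.
Qed.

(** The sign of [g] is known only on the diagonal of [X], so the accumulation point must come from
    [X]; the second hypothesis provides it. *)
Lemma diagonal_le0 (R : realType) (X K : topologicalType) (e : X -> K)
    (g : K -> K -> R) :
  compact [set: K] ->
  (forall V : nat -> set K, (forall n, open (V n)) -> (forall n, V n !=set0) ->
    exists z, forall O, nbhs (e z) O -> forall N,
      exists2 n, (N <= n)%N & O `&` V n !=set0) ->
  (forall r, continuous (g^~ r)) -> (forall p, continuous (g p)) ->
  (forall x, g (e x) (e x) <= 0) -> forall q, g q q <= 0.
Proof.
move=> cK clu cg1 cg2 g0 q; rewrite leNgt; apply/negP => gq.
pose a := g q q / 2; have a0 : 0 < a by rewrite divr_gt0.
pose T : Type := K * set K.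
pose I (n : nat) (x : T) := [/\ open x.2, x.2 x.1, a < g q x.1 &
  forall p, x.2 p -> forall z, `|g z p - g z x.1| <= a / 2].
pose J (n : nat) (y x : T) := forall p, x.2 p -> a < g p y.1.
have [u uP] : exists u : nat -> T,
    forall n, I n (u n) /\ forall j, (j < n)%N -> J n (u j) (u n).
  apply: (history_choice (q, setT)) => n v vP.
  have aq : a < g q q by rewrite /a; lra.
  have : nbhs q [set p | a < g q p /\ forall j, (j < n)%N -> a < g p (v j).1].
    apply: filterI; first exact: (cvgr_gt _ (cg2 q q)).
    apply: near_all_ltn => j jn.
    by apply: (cvgr_gt _ (cg1 (v j).1 q)); have [[]] := vP j jn.
  rewrite nbhsE => -[W [opW Wq] WP].
  (* The variables are swapped: the oscillation in the second one is to be small uniformly in the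
     first. *)
  have [||o Wo] := @near_equicontinuous R K K (fun o z => g z o) W (a / 2) cK cK
    cg2 cg1 opW.
  - by exists q.
  - by rewrite divr_gt0.
  move=> near_o.
  have : nbhs o [set p | W p /\ forall z, `|g z p - g z o| <= a / 2].
    by apply: filterI => //; exact: open_nbhs_nbhs.
  rewrite nbhsE => -[V [opV Vo] VP]; exists (o, V); split.
    by split=> //=; [have [] := WP _ Wo|move=> p /VP[]].
  by move=> j jn p /VP[/WP[_ +] _]; apply.
have [||z zP] := clu (fun n => (u n).2).
- by move=> n; have [[]] := uP n.
- by move=> n; have [[_ un _ _] _] := uP n; exists (u n).1.
(* All later open sets lie where [g] at [(u n).1] exceeds [a], and they accumulate at [e z]. *)
have zu n : a <= g (e z) (u n).1.
  rewrite leNgt; apply/negP => zn.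
  have [m nm [p [pn pm]]] := zP _ (cvgr_lt _ (cg1 (u n).1 (e z)) _ zn) n.+1.
  have [_ /(_ n nm p pm)] := uP m.
  by move=> /lt_trans/(_ pn); rewrite ltxx.
have zz : g (e z) (e z) < a / 2.
  by apply: le_lt_trans (g0 z) _; rewrite divr_gt0.
have [n _ [p [pn pm]]] := zP _ (cvgr_lt _ (cg2 (e z) (e z)) _ zz) 0%N.
have [[_ _ _ /(_ p pm (e z)) uz] _] := uP n.
move: uz; rewrite ler_norml => /andP[+ _]; have := zu n; move: pn => /=; lra.
Qed.

(** * Function spaces and Grothendieck pairs *)

Lemma Cp_continuous (R : realType) (S T : topologicalType) (phi : S -> Cp R T) :
  (forall t, continuous (fun s => phi s t)) -> continuous phi.
Proof.
move=> cphi; apply: (@continuous_comp_initial _ _ _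
  (fun f : continuousType T R => (f : {ptws T -> R})) phi).
move=> s; have [_ H] := @pointwise_cvgP T R
  ((fun s => (phi s : {ptws T -> R})) @ s) (phi s) _.
by apply: H => t; exact: cphi.
Qed.

Lemma Cp_eval_continuous (R : realType) (T : topologicalType) (t : T) :
  continuous (fun f : Cp R T => f t).
Proof.
move=> f; pose w (g : continuousType T R) : {ptws T -> R} := g.
exact: (cvg_comp _ _ (@initial_continuous _ _ w f)
  (@proj_continuous T (fun=> R) t (w f))).
Qed.

(** Sending [s] to the constant function [h s] maps [S] into a set with compact closure, whose
    evaluation at [t] is bounded. *)
Lemma grothendieck_bounded (R : realType) (S T : topologicalType) (t : T) :
  grothendieck_pair R S T ->
  forall h : S -> R, continuous h -> exists M, forall s, h s <= M.
Proof.
move=> gST h ch.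
have cc s : continuous (fun _ : T => h s) by move=> ?; exact: cvg_cst.
pose phi s : Cp R T := mkcts (cc s).
have cphi : continuous phi by apply: Cp_continuous => t' s; exact: ch.
have /compact_bounded[M [_ bM]] : compact
    ((fun f : Cp R T => f t) @` closure (range phi)).
  apply: continuous_compact (gST phi cphi).
  by apply: continuous_subspaceT; exact: Cp_eval_continuous.
exists (M + 1) => s; apply: le_trans (ler_norm _) _.
apply: (bM (M + 1)); first by rewrite ltrDl.
by exists (phi s) => //; apply: subset_closure; exists s.
Qed.

(** Extending in the first variable keeps continuity in the second: for real [f], the map
    [f \o F1 p] is a pointwise limit of the [f \o F s], and compactness of their closure in [Cp R T]
    makes the limit continuous. *)
Lemma grothendieck_extension (R : realType) (S T bS K : topologicalType)
    (e : S -> bS) (F : S -> T -> K) (F1 : bS -> T -> K) :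
  grothendieck_pair R S T -> dense (range e) ->
  hausdorff_space K -> compact [set: K] ->
  (forall s, continuous (F s)) -> (forall t, continuous (F1^~ t)) ->
  continuous e -> (forall s t, F1 (e s) t = F s t) ->
  forall p, continuous (F1 p).
Proof.
move=> gST de hK cK cF cF1 ce F1e p.
apply: (compact_continuous (R := R)) => // f cf.
have cfF s : continuous (f \o F s).
  by move=> t; apply: continuous_comp; [exact: cF|exact: cf].
pose phi s : Cp R T := mkcts (cfF s).
have cphi : continuous phi.
  apply: Cp_continuous => t s.
  have -> : (fun s => phi s t) = f \o F1^~ t \o e.
    by apply/funext => s' /=; rewrite F1e.
  apply: continuous_comp; first exact: ce.
  by apply: continuous_comp; [exact: cF1|exact: cf].
have [G [GU eG]] := dense_ultra p de.
have [|psi phi_psi] := ultra_compact_cvg (u := phi) GU (gST phi cphi).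
  by move=> s; apply: subset_closure; exists s.
have -> : f \o F1 p = psi; last exact: cts_fun.
apply/funext => t; apply: (cvg_unique (@Rhausdorff R) (F := (phi^~ t) @ G)).
  have -> : phi^~ t = f \o F1^~ t \o e.
    by apply/funext => s' /=; rewrite F1e.
  have cfF1 : {for p, continuous (f \o F1^~ t)}.
    by apply: continuous_comp; [exact: cF1|exact: cf].
  exact: (cvg_comp _ _ eG cfF1).
exact: (cvg_comp _ _ phi_psi (@Cp_eval_continuous R T t psi)).
Qed.

(** * Dense images of pseudocompact spaces *)

Lemma topological_embedding_continuous (X bX : topologicalType) (e : X -> bX) :
  topological_embedding e -> continuous e.
Proof.
by move=> [_ eo]; apply/continuousP => V oV; apply/eo; exists V.
Qed.

Lemma dense_range_cluster (R : realType) (X bX : topologicalType)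
    (e : X -> bX) (V : nat -> set bX) :
  completely_regular_space X ->
  (forall h : X -> R, continuous h -> exists M, forall x, h x <= M) ->
  continuous e -> dense (range e) ->
  (forall n, open (V n)) -> (forall n, V n !=set0) ->
  exists z, forall O, nbhs (e z) O -> forall N,
    exists2 n, (N <= n)%N & O `&` V n !=set0.
Proof.
move=> cr bd ce de oV V0.
have [||z zP] := locally_finite_cluster (U := fun n => e @^-1` V n) cr bd.
- by move=> n; apply: open_comp => // x _; exact: ce.
- move=> n; have [y [Vy [x _ xE]]] := de _ (V0 n) (oV n).
  by exists x; rewrite /= xE.
exists z => A zA N; have [n Nn [x [Ax Vx]]] := zP _ (ce z A zA) N.
by exists n => //; exists (e x).
Qed.

(** Let [V n] be a neighbourhood of [p] on which the first [n] functions vary by less than 1/n; a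
    point of [X] where the [V n] accumulate has the required values. *)
Lemma dense_range_zero_set (R : realType) (X bX : topologicalType)
    (e : X -> bX) (h : nat -> bX -> R) (p : bX) :
  completely_regular_space X ->
  (forall h : X -> R, continuous h -> exists M, forall x, h x <= M) ->
  continuous e -> dense (range e) ->
  (forall n, continuous (h n)) -> exists x, forall n, h n (e x) = h n p.
Proof.
move=> cr bd ce de ch.
have near_p n : nbhs p
    [set q | forall i, (i < n)%N -> `|h i q - h i p| < n%:R^-1].
  case: n => [|n]; first exact: filterE.
  by apply: near_all_ltn => i _; apply: near_dist; [exact: ch|].
have /choice[V VP] : forall n, exists V : set bX, open_nbhs p V /\
    forall q, V q -> forall i, (i < n)%N -> `|h i q - h i p| < n%:R^-1.
  by move=> n; have := near_p n; rewrite nbhsE => -[V pV VP]; exists V.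
have [||x xP] := dense_range_cluster (V := V) cr bd ce de.
- by move=> n; have [[]] := VP n.
- by move=> n; exists p; have [[]] := VP n.
exists x => i; apply/eqP/negPn/negP => hip.
(* Half of the supposed discrepancy: [q] will be within [d] of both values once [n] exceeds [i] and
   1/d. *)
pose d := `|h i (e x) - h i p| / 2.
have d0 : 0 < d by rewrite divr_gt0// normr_gt0 subr_eq0.
have [n le_n [q [qd Vq]]] := xP _ (near_dist (ch i (e x)) d0)
  (maxn i.+1 (Num.truncn d^-1).+1).
have {le_n}[lt_in lt_dn] : (i < n)%N /\ n%:R^-1 < d.
  move: le_n; rewrite geq_max => /andP[-> le_dn]; split=> //.
  rewrite invf_plt ?posrE//; last by rewrite ltr0n (leq_trans _ le_dn).
  by apply: lt_le_trans (truncnS_gt _) _; rewrite ler_nat.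
have [_ /(_ q Vq i lt_in)] := VP n.
have : `|h i (e x) - h i p| <= `|h i (e x) - h i q| + `|h i q - h i p|.
  exact: ler_distD.
move: qd; rewrite /= distrC.
have -> : `|h i (e x) - h i p| = d + d by rewrite /d; lra.
lra.
Qed.

(** * Extension of separately continuous maps of two variables *)

Lemma korovin_bounded (R : realType) (X : topologicalType) :
  korovin_space R X ->
  forall h : X -> R, continuous h -> exists M, forall x, h x <= M.
Proof.
move=> [_ gX] h ch; have [[x0 _]|nX] := pselect (exists x : X, True).
  exact: grothendieck_bounded x0 gX h ch.
by exists 0 => x; exfalso; apply: nX; exists x.
Qed.

(* F2 extends F in the first variable first, G2 in the second. Were they to
   differ at (q, p), one could choose points x_n, y_n such that f (F x_n y_m) is
   1 for n < m and 0 for n > m. A point x of X that agrees with the limit of the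
   x_n on all y_m and on their limit q' then contradicts the continuity in q' of
   the extension of F x. *)
Lemma separately_continuous_extension (R : realType)
    (X bX K : topologicalType) (e : X -> bX) (F : X -> X -> K) :
  korovin_space R X -> stone_cech_compactification e ->
  hausdorff_space K -> compact [set: K] ->
  (forall y, continuous (F^~ y)) -> (forall x, continuous (F x)) ->
  exists F' : bX -> bX -> K, [/\ forall q, continuous (F'^~ q),
    forall p, continuous (F' p) & forall x y, F' (e x) (e y) = F x y].
Proof.
move=> kX [[_ cbX emb de] ext] hK cK cF1 cF2.
have ce := topological_embedding_continuous emb.
have cr : completely_regular_space X by have [[]] := kX.
have gX : grothendieck_pair R X X by have [] := kX.
have bd := korovin_bounded kX.
have extend T (g : X -> T -> K) : (forall t, continuous (g^~ t)) ->
    exists g' : bX -> T -> K,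
      (forall t, continuous (g'^~ t)) /\ forall x t, g' (e x) t = g x t.
  move=> cg; have /choice[g' g'P] : forall t, exists g' : bX -> K,
      continuous g' /\ forall x, g' (e x) = g x t.
    by move=> t; have [g' cg' g'E] := ext K _ hK cK (cg t); exists g'.
  by exists (fun p t => g' t p); split=> [t|x t]; have [] := g'P t.
have [F1 [cF11 F1E]] := extend _ F cF1.
have [G [cG1 GE]] := extend _ (fun y x => F x y) cF2.
have cF12 : forall p, continuous (F1 p).
  exact: (grothendieck_extension gX de hK cK cF2 cF11 ce F1E).
have cG2 : forall q, continuous (G q).
  exact: (grothendieck_extension gX de hK cK cF1 cG1 ce GE).
have [F2 [cF2' F2E]] := extend _ (fun y p => F1 p y) cF12.
have [G2 [cG2' G2E]] := extend _ (fun x q => G q x) cG2.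
(* [F2] is continuous in [q] and [G2] in [p], so their equality gives separate continuity. *)
suff F2G2 p q : F2 q p = G2 p q.
  exists G2; split=> [q|p|x y]; first exact: cG2'.
    have -> : G2 p = F2^~ p by apply/funext => q; rewrite F2G2.
    exact: cF2'.
  by rewrite G2E GE.
apply: contrapT => /(compact_separation R hK cK)[f [cf fF fG]].
have zero h r := @dense_range_zero_set R X bX e h r cr bd ce de.
(* Any point of [X], as default value for the choice below. *)
have [|x0 _] := zero (fun _ _ => 0) p; first by move=> n; exact: cst_continuous.
have fc (h : bX -> K) : continuous h -> continuous (f \o h).
  by move=> ch r; apply: continuous_comp; [exact: ch|exact: cf].
pose T : Type := X * X.
pose I (n : nat) (s : T) := f (F1 p s.2) = 0 /\ f (G q s.1) = 1.
pose J (n : nat) (r s : T) := f (F r.1 s.2) = 1 /\ f (F s.1 r.2) = 0.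
have [u uP] : exists u : nat -> T,
    forall n, I n (u n) /\ forall j, (j < n)%N -> J n (u j) (u n).
  apply: (history_choice (x0, x0)) => n v vP.
  (* Index 0 encodes condition [I], index [j.+1] the relation to [v j]. The new [y] imitates [q],
     and the new [x] imitates [p]. *)
  have [|y yP] := zero
    (fun m => if m is j.+1 then f \o G^~ (v j).1 else f \o F2^~ p) q.
    by case=> [|j]; apply: fc; [exact: cF2'|exact: cG1].
  have [|x xP] := zero
    (fun m => if m is j.+1 then f \o F1^~ (v j).2 else f \o G2^~ q) p.
    by case=> [|j]; apply: fc; [exact: cG2'|exact: cF11].
  exists (x, y); split; first split.
  - by have := yP 0%N; rewrite /= F2E fF.
  - by have := xP 0%N; rewrite /= G2E fG.
  - move=> j jn; have [[F1v Gv] _] := vP j jn; split.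
      by have := yP j.+1; rewrite /= GE Gv.
    by have := xP j.+1; rewrite /= F1E F1v.
have [A [AU ooA]] := free_ultrafilter.
have [q' yq] := ultra_compact_cvg (u := fun n => e (u n).2) AU cbX
  (fun=> Logic.I).
have [p' xp] := ultra_compact_cvg (u := fun n => e (u n).1) AU cbX
  (fun=> Logic.I).
have lim (w : nat -> bX) (r : bX) (h : bX -> K) (a : R) n : w @ A --> r ->
    continuous h -> (forall m, (n < m)%N -> f (h (w m)) = a) -> f (h r) = a.
  move=> wr ch hw; have fhw := cvg_comp _ _ wr (fc h ch r).
  apply: (closed_cvg (fun b => b = a) (@closed_eq _ a) _ _ fhw).
  by apply: ooA; apply: filterS (nbhs_infty_gt n) => m; exact: hw.
have Gq n : f (G q' (u n).1) = 1.
  apply: (lim _ _ (G^~ (u n).1) _ n yq); first exact: cG1.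
  by move=> m nm; have [_ /(_ n nm)[+ _]] := uP m; rewrite GE.
have F1p n : f (F1 p' (u n).2) = 0.
  apply: (lim _ _ (F1^~ (u n).2) _ n xp); first exact: cF11.
  by move=> m nm; have [_ /(_ n nm)[_ +]] := uP m; rewrite F1E.
have G2pq : f (G2 p' q') = 1.
  apply: (lim _ _ (G2^~ q') _ 0%N xp); first exact: cG2'.
  by move=> m _; rewrite G2E.
have [|x xP] := zero
  (fun m => if m is j.+1 then f \o F1^~ (u j).2 else f \o G2^~ q') p'.
  by case=> [|j]; apply: fc; [exact: cG2'|exact: cF11].
have : f (G q' x) = 0.
  apply: (lim _ _ (G^~ x) _ 0%N yq); first exact: cG1.
  by move=> m _; have := xP m.+1; rewrite /= F1E GE F1p.
have := xP 0%N; rewrite /= G2E G2pq => -> /eqP.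
by rewrite oner_eq0.
Qed.

(** * Extension of the Mal'cev operation and its identities *)

Theorem theorem4 (R : realType) (X : topologicalType) (mu : X -> X -> X -> X)
    (hmu : semitopological_malcev_algebra mu) (hX : korovin_space R X)
    (bX : topologicalType) (e : X -> bX)
    (he : stone_cech_compactification e) :
  exists mu' : bX -> bX -> bX -> bX,
    [/\ malcev_operation mu', separately_continuous mu' &
        forall x y z : X, mu' (e x) (e y) (e z) = e (mu x y z)].
Proof.
have [_ malcev [cmu1 cmu2 cmu3]] := hmu.
have [[hbX cbX emb de] _] := he.
have ce := topological_embedding_continuous emb.
have cr : completely_regular_space X by have [[]] := hX.
have extend F :=
  @separately_continuous_extension R X bX bX e F hX he hbX cbX.
have cce (h : bX -> bX) : continuous h -> continuous (fun w => h (e w)).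
  by move=> ch w; apply: continuous_comp; [exact: ce|exact: ch].
have ceh (h : X -> X) : continuous h -> continuous (fun w => e (h w)).
  by move=> ch w; apply: continuous_comp; [exact: ch|exact: ce].
have eq_on_range f g := dense_eq (f := f) (g := g) hbX de.
(* [A z] fixes the third variable in [X] and [D y] the second. Their agreement [AD] makes
   [A z p (e y)] continuous in [z], so that [B p] can be built for each [p] in [bX]. *)
have /choice[A AP] : forall z, exists A : bX -> bX -> bX,
    [/\ forall q, continuous (A^~ q), forall p, continuous (A p) &
      forall x y, A (e x) (e y) = e (mu x y z)].
  move=> z; apply: (extend (fun x y => e (mu x y z))) => [y|x].
    exact: ceh (cmu1 y z).
  exact: ceh (cmu2 x z).
have /choice[D DP] : forall y, exists D : bX -> bX -> bX,
    [/\ forall r, continuous (D^~ r), forall p, continuous (D p) &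
      forall x z, D (e x) (e z) = e (mu x y z)].
  move=> y; apply: (extend (fun x z => e (mu x y z))) => [z|x].
    exact: ceh (cmu1 y z).
  exact: ceh (cmu3 x y).
have AD p y z : A z p (e y) = D y p (e z).
  have [A1 _ AE] := AP z; have [D1 _ DE] := DP y.
  by apply: (eq_on_range (A z^~ (e y)) (D y^~ (e z))) p => // x; rewrite AE DE.
have /choice[B BP] : forall p, exists B : bX -> bX -> bX,
    [/\ forall r, continuous (B^~ r), forall q, continuous (B q) &
      forall y z, B (e y) (e z) = A z p (e y)].
  move=> p; apply: (extend (fun y z => A z p (e y))) => [z|y].
    by have [_ A2 _] := AP z; exact: cce (A2 p).
  under eq_fun do rewrite AD.
  by have [_ D2 _] := DP y; exact: cce (D2 p).
have BA p q z : B p q (e z) = A z p q.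
  have [B1 _ BE] := BP p; have [_ A2 _] := AP z.
  by apply: (eq_on_range ((B p)^~ (e z)) (A z p)) q => // y; rewrite BE.
(* Each [B p] was chosen separately, so continuity in [p] needs another extension [C], with [q]
   fixed; density in [p] and then in [r] identifies it with [B]. *)
have cB q r : continuous (fun p => B p q r).
  have [||C [C1 C2 CE]] := extend (fun x z => B (e x) q (e z)).
  - move=> z; under eq_fun do rewrite BA.
    by have [A1 _ _] := AP z; exact: cce (A1 q).
  - by move=> x; have [_ B2 _] := BP (e x); exact: cce (B2 q).
  have CA p z : C p (e z) = A z p q.
    have [A1 _ _] := AP z.
    by apply: (eq_on_range (C^~ (e z)) ((A z)^~ q)) p => // x; rewrite CE BA.
  have -> : (fun p => B p q r) = C^~ r; last exact: C1.
  apply/funext => p; have [_ B2 _] := BP p.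
  by apply: (eq_on_range (B p q) (C p)) r => // z; rewrite CA BA.
have BE x y z : B (e x) (e y) (e z) = e (mu x y z).
  by rewrite BA; have [_ _ ->] := AP z.
have bd := korovin_bounded hX.
have clu V := dense_range_cluster (V := V) cr bd ce de.
have diagonal (H : bX -> bX -> bX) (c : bX) : (forall r, continuous (H^~ r)) ->
    (forall p, continuous (H p)) -> (forall x, H (e x) (e x) = c) ->
    forall q, H q q = c.
  move=> H1 H2 Hc q; apply: contrapT => Hq.
  have [f [cf fc fq]] : exists f : bX -> R,
      [/\ continuous f, f c = 0 & f (H q q) = 1].
    by apply: compact_separation => // cH; exact: Hq.
  have cfh (h : bX -> bX) : continuous h -> continuous (fun p => f (h p)).
    by move=> ch p; apply: continuous_comp; [exact: ch|exact: cf].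
  suff : f (H q q) <= 0 by rewrite fq ler10.
  apply: (@diagonal_le0 R X bX e (fun p r => f (H p r)) cbX clu).
  - by move=> r; exact: cfh (H1 r).
  - by move=> p; exact: cfh (H2 p).
  - by move=> x; rewrite Hc fc.
exists B; split=> //.
- move=> p q; split.
    (* Density disposes of the variable that occurs once, leaving it in [X]; [diagonal] treats the
       repeated one. *)
    suff : B q q =1 id by move=> ->.
    apply: eq_on_range => [|r|x]; [by have [_ B2 _] := BP q|exact: cvg_id|].
    apply: (diagonal (fun y z => B y z (e x)) (e x)) => [r|r|y].
    + exact: cB.
    + by have [B1 _ _] := BP r.
    + by rewrite BE; have [-> _] := malcev x y.
  suff : (fun p => B p q q) =1 id by move=> ->.
  apply: eq_on_range => [|r|x]; [exact: cB|exact: cvg_id|].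
  have [B1 B2 _] := BP (e x); apply: (diagonal (B (e x)) (e x)) => // y.
  by rewrite BE; have [_ ->] := malcev x y.
- split=> [q r|p r|p q]; first exact: cB.
    by have [B1 _ _] := BP p.
  by have [_ B2 _] := BP p.
Qed.
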